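(* Let $X=\prod\{X_s : s\in S\}$ be a product (with the product topology) of an arbitrary family of spaces each of which is connected, locally connected, winnable and an $SC$ space. Then every preserving function from $X$ into any $T_3$ space is continuous. In particular, if $X=\prod\{X_s : s\in S\}$ where each factor $X_s$ is either a connected linearly ordered space (with the order topology) or a connected and locally connected first countable space, then every preserving function from $X$ into any $T_3$ space is continuous.
   Context: A function $f:X\to Y$ between topological spaces (not assumed continuous) is called preserving if the image of every compact subspace of $X$ is compact in $Y$ and the image of every connected subspace of $X$ is connected in $Y$. Compact means that every open cover has a finite subcover. $T_3$ means regular and $T_1$. A point $x$ of a space $X$ is an $SC$ (sequentially connectible) point if, whenever $x_n\in X$ and $x_n\to x$, there are an infinite subsequence $\langle x_{n_k}:k<\omega\rangle$ and a sequence $\langle C_k:k<\omega\rangle$ of connected subsets of $X$ such that $\{x_{n_k},x\}\subset C_k$ for all $k<\omega$ and $C_k\to x$, i.e. every neighbourhood of $x$ contains all but finitely many of the $C_k$. $X$ is an $SC$ space if all its points are $SC$ points. For a space $X$ and $p\in X$, the game $G(X,p)$ is played by players I and II in $\omega$ rounds. In the $n$-th round, first I chooses a neighbourhood $U_n$ of $p$ and then II chooses a point $x_n\in U_n$. Player I wins if the produced sequence $\langle x_n:n<\omega\rangle$ has a subsequence converging to some point of $X$; otherwise II wins. $X$ is winnable at $p$ if I has a winning strategy in $G(X,p)$, that is, a map $\sigma$ from the set $X^{<\omega}$ of finite sequences of points of $X$ to the neighbourhoods of $p$ such that every sequence $\langle x_n:n<\omega\rangle$ with $x_n\in\sigma\langle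 x_0,\dots,x_{n-1}\rangle$ for all $n<\omega$ has a convergent subsequence. $X$ is winnable if it is winnable at each of its points. *)

(* Defs.v *)
From mathcomp Require Import all_boot all_order all_classical.
From mathcomp Require Import topology function_spaces.

Set Implicit Arguments.
Unset Strict Implicit.
Unset Printing Implicit Defensive.

Local Open Scope classical_set_scope.

Definition preserving (X Y : topologicalType) (f : X -> Y) : Prop :=
  (forall A : set X, cover_compact A -> cover_compact (f @` A)) /\
  (forall A : set X, connected A -> connected (f @` A)).

(* [regular_space] does not include any separation of points. *)
Definition T3_space (Y : topologicalType) : Prop :=
  regular_space Y /\ accessible_space Y.

Definition connected_space (X : topologicalType) : Prop :=
  connected [set: X].

Definition locally_connected (X : topologicalType) : Prop :=
  forall (x : X) (U : set X), nbhs x U ->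
    exists V : set X, [/\ open V, V x, connected V & V `<=` U].

Definition first_countable (X : topologicalType) : Prop :=
  forall x : X, exists B : set (set X),
    [/\ countable B,
        forall V, B V -> nbhs x V
      & forall U, nbhs x U -> exists2 V, B V & V `<=` U].

Definition strictly_increasing (k : nat -> nat) : Prop :=
  {homo k : i j / (i < j)%N}.

Definition SC_point (X : topologicalType) (x : X) : Prop :=
  forall u : nat -> X, u @ \oo --> x ->
    exists (k : nat -> nat) (C : nat -> set X),
      [/\ strictly_increasing k,
          forall i, connected (C i),
          forall i, C i (u (k i)) /\ C i x
        & forall U : set X, nbhs x U -> \forall i \near \oo, C i `<=` U].

Definition SC_space (X : topologicalType) : Prop :=
  forall x : X, SC_point x.

Definition has_convergent_subsequence (X : topologicalType) (u : nat -> X) :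
    Prop :=
  exists (k : nat -> nat) (q : X),
    strictly_increasing k /\ (u \o k) @ \oo --> q.

(* [mkseq x n] is the finite sequence x_0, ..., x_(n-1) of the moves of player
   II before round n. *)
Definition winning_strategy (X : topologicalType) (p : X)
    (sigma : seq X -> set X) : Prop :=
  (forall s : seq X, nbhs p (sigma s)) /\
  (forall x : nat -> X, (forall n, sigma (mkseq x n) (x n)) ->
     has_convergent_subsequence x).

Definition winnable_at (X : topologicalType) (p : X) : Prop :=
  exists sigma : seq X -> set X, winning_strategy p sigma.

Definition winnable (X : topologicalType) : Prop :=
  forall p : X, winnable_at p.

(* [X] carries the order topology of some linear order on its points. The order
   is given through a homeomorphism [h] with an [orderTopologicalType], from
   which it is pulled back to [X]; this avoids comparing the choice structures
   bundled in [X] and [L]. *)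
Definition linearly_ordered_space (X : topologicalType) : Prop :=
  exists (d : Order.disp_t) (L : orderTopologicalType d)
         (h : X -> L) (g : L -> X),
    [/\ cancel h g, cancel g h, continuous h & continuous g].

(* Main.v *)
Require Import Defs.
From mathcomp Require Import all_boot all_order all_classical.
From mathcomp Require Import finmap interval.
From mathcomp Require Import topology function_spaces.

(** Let [f] be a preserving function on a product [X], let [p] be a point of
[X], and let [sigma(p)] (formally [finite_change p]) be the set of the points of
[X] that differ from [p] in finitely many coordinates. In every box around [p]
the points of [sigma(p)] are dense.
Continuity at [p] comes from two facts.

- The restriction of [f] to [sigma(p)] is continuous at [p]
  ([within_cvg_of_strategy], applied to the strategy of [prod_strategy]).
- If [E] is connected then [f] maps [closure E] into the closure of [f @` E]
  ([image_closure_connected]): for [x] in the closure of [E] the image of the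
  connected set [E `|` [set x]] is connected, and a point [f x] outside the
  closure of [f @` E] would be isolated in it.

For a neighbourhood [V] of [f p] choose a neighbourhood [W] with
[closure W `<=` V]. By the first fact [f] maps [U `&` sigma(p)] into [W] for
some box [U] around [p], and local connectedness of the factors makes [U] a product
of connected sets. Then [U `&` sigma(p)] is connected and dense in [U], so by
the second fact [f] maps [U] into [closure W].

The first fact rests on a lemma about shrinking connected sets
([image_shrinking_connected]): if connected sets [C i] contain [x] and converge
to [x], then the sets [f @` C i] converge to [f x]. Suppose that [f] restricted
to [sigma(p)] is not continuous at [p], as witnessed by a neighbourhood [W0] of
[f p], and let [H] be the complement of a smaller closed neighbourhood of [f p].
By the second fact no component of [f @^-1` H] has [p] in its closure. So
player II, playing in [sigma(p)] against any strategy, can choose each [x n]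
with [f (x n)] outside [W0] and in a component of [f @^-1` H] other than those
of the earlier moves. If a subsequence of the play is joined to a limit [q] by
connected sets converging to [q], then by the shrinking lemma almost all of
these sets lie in [f @^-1` H]. As they share the point [q], two different moves
lie in one component, a contradiction.

It remains to give player I a strategy at [p], against moves in [sigma(p)],
such that some subsequence of each play is joined to its limit in this way. The
moves have finite supports, so at each round only finitely many coordinates
have ever differed from those of [p], and in each of them player I follows a
winning strategy of the factor. These strategies are first made hereditary, so
that they win along every subsequence of a play; then a diagonal subsequence
converges in all coordinates, and products of connected sets join it to its
limit.

For the second statement the hypotheses of the first one are checked for the
factors. In a first countable space player I plays a shrinking sequence of
neighbourhoods. In a connected linearly ordered space the order convex sets are
connected, and a constant bounded neighbourhood is a winning strategy, because
a bounded sequence has a monotone subsequence and bounded sets have suprema and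
infima. *)

Set Implicit Arguments.
Unset Strict Implicit.
Unset Printing Implicit Defensive.

Local Open Scope classical_set_scope.

(** * Subsequences and plays *)

Lemma strictly_increasing_ge k : strictly_increasing k -> forall n, (n <= k n)%N.
Proof. by move=> kinc; elim=> // n /leq_ltn_trans; apply; exact: kinc. Qed.

Lemma strictly_increasing_comp k h :
  strictly_increasing k -> strictly_increasing h -> strictly_increasing (k \o h).
Proof. by move=> kinc hinc i j /hinc/kinc. Qed.

Lemma strictly_increasingS k : (forall n, k n < k n.+1)%N -> strictly_increasing k.
Proof.
move=> kS i j; elim: j => // j IH; rewrite ltnS leq_eqVlt => /predU1P[->//|/IH].
by move/ltn_trans; apply.
Qed.

Lemma extract_subsequence (P : nat -> nat -> Prop) :
  (forall n N, exists2 m, (N <= m)%N & P n m) ->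
  exists2 k, strictly_increasing k & forall n, P n (k n).
Proof.
move=> PP; have /choice[g gP] : forall nN : nat * nat, exists m,
    (nN.2 <= m)%N /\ P nN.1 m.
  by move=> [n N]; have [m Nm Pm] := PP n N; exists m.
pose k := fix k n := if n is m.+1 then g (n, (k m).+1) else g (0, 0).
exists k; first by apply: strictly_increasingS => n; have [] := gP (n.+1, (k n).+1).
by case=> [|n]; [have [] := gP (0, 0)|have [] := gP (n.+1, (k n).+1)].
Qed.

(** The stability hypothesis on [P] covers every [d] that from some index on takes
values of [k] at arguments not smaller than its own; the diagonal sequence has
this property with respect to all the nested subsequences. *)
Lemma diagonal_subsequence (P : nat -> (nat -> nat) -> Prop) :
  (forall j k, strictly_increasing k ->
    exists2 h, strictly_increasing h & P j (k \o h)) ->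
  (forall j k d N, P j k ->
    (forall i, (N <= i)%N -> exists2 m, (i <= m)%N & d i = k m) -> P j d) ->
  exists2 d, strictly_increasing d & forall j, P j d.
Proof.
move=> ex_sub P_sub.
have /choice[g gP] : forall jk : nat * (nat -> nat), exists h,
    strictly_increasing jk.2 -> strictly_increasing h /\ P jk.1 (jk.2 \o h).
  move=> [j k]; have [/(ex_sub j)[h hinc Ph]|] := pselect (strictly_increasing k).
    by exists h.
  by exists id.
pose K := fix K n := if n is m.+1 then K m \o g (m, K m) else id.
have Kinc n : strictly_increasing (K n).
  elim: n => [|n IH] //; apply: strictly_increasing_comp => //.
  by have [] := gP (n, K n) IH.
have ginc n : strictly_increasing (g (n, K n)) by have [] := gP (n, K n) (Kinc n).
exists (fun i => K i i).
  apply: strictly_increasingS => i /=; apply: Kinc.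
  exact: (strictly_increasing_ge (ginc i) i.+1).
move=> j; have [_ PK] := gP (j, K j) (Kinc j).
apply: (P_sub j (K j.+1) _ j.+1 PK) => i ji.
suff /(_ i)[m im ->] : forall l, exists2 m, (l <= m)%N & K i l = K j.+1 m by exists m.
elim: i ji => // i IH; rewrite leq_eqVlt => /predU1P[->|/IH{}IH] l; first by exists l.
have [m lm Km] := IH (g (i, K i) l); exists m => //.
exact: leq_trans (strictly_increasing_ge (ginc i) l) lm.
Qed.

Lemma subseq_mkseq (T : eqType) (x : nat -> T) k n :
  strictly_increasing k -> subseq (mkseq (x \o k) n) (mkseq x (k n)).
Proof.
move=> kinc; elim: n => [|n IH]; first exact: sub0seq.
rewrite mkseqS; apply: (@subseq_trans _ (mkseq x (k n).+1)).
  by rewrite mkseqS -!cats1 cat_subseq.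
have -> : k n.+1 = ((k n).+1 + (k n.+1 - (k n).+1))%N.
  by rewrite subnKC//; exact: kinc.
by rewrite /mkseq iotaD map_cat prefix_subseq.
Qed.

Lemma infinite_play (X : Type) (R : seq X -> X -> Prop) :
  (forall s, exists x, R s x) -> exists x : nat -> X, forall n, R (mkseq x n) (x n).
Proof.
move=> /choice[g gP].
pose h := fix h n := if n is m.+1 then rcons (h m) (g (h m)) else [::].
exists (g \o h) => n; suff -> : mkseq (g \o h) n = h n by exact: gP.
by elim: n => // n IH; rewrite mkseqS IH.
Qed.

(** * Connected sets and preserving functions *)

Lemma filter_all_seq (T : Type) (I : eqType) (F : set_system T) (t : seq I)
    (G : I -> set T) :
  Filter F -> (forall i, i \in t -> F (G i)) ->
  F [set z | forall i, i \in t -> G i z].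
Proof.
move=> FF; elim: t => [|i t IH] FG; first by apply: filterS filterT.
have := IH (fun j jt => FG j (mem_behead (s := i :: t) jt)).
have := FG i (mem_head i t); apply: filterS2 => z Giz tz j.
by rewrite inE => /predU1P[->//|]; exact: tz.
Qed.

Lemma connected_split (X : topologicalType) (B U V : set X) (b : X) :
  connected B -> open U -> open V -> B `<=` U `|` V ->
  (forall z, B z -> U z -> ~ V z) -> B b -> U b -> B `<=` U.
Proof.
move=> cB oU oV BUV UV Bb Ub; suff <- : B `&` U = B by move=> z [].
apply: cB; first by exists b.
  by exists U.
exists (~` V); first exact: open_closedC.
apply/seteqP; split=> z [Bz Hz]; split=> //; first exact: UV.
by case: (BUV z Bz).
Qed.

Lemma connected_between (X : topologicalType) (E B : set X) :
  connected E -> E `<=` B -> B `<=` closure E -> connected B.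
Proof.
move=> cE EB BE; apply/connectedP => G [G0 GB [s1 s2]].
have [|EG|EG] := connected_subset (conj s1 s2) _ cE; first by rewrite -GB.
- have [z Gz] := G0 true; have : (closure (G false) `&` G true) z.
    by split=> //; apply: (closureS EG); apply: BE; rewrite GB; right.
  by rewrite s1.
- have [z Gz] := G0 false; have : (G false `&` closure (G true)) z.
    by split=> //; apply: (closureS EG); apply: BE; rewrite GB; left.
  by rewrite s2.
Qed.

(** For [x] in [closure E] the set [f @` E `|` [set (f x)]] is connected, as the
image of a connected set. If [f x] were not in the closure of [f @` E], the point
[f x] would be open in that set, and it is closed there because [Y] is T1. *)
Lemma image_closure_connected (X Y : topologicalType) (f : X -> Y) (E : set X) :
  accessible_space Y -> preserving f -> connected E ->
  f @` closure E `<=` closure (f @` E).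
Proof.
move=> T1 [_ fC] cE _ [x clx <-].
apply: contrapT => ncl.
have [e [Ee _]] : E `&` setT !=set0 by apply: clx; exact: filterT.
have cB : connected (f @` (E `|` [set x])).
  apply: fC; apply: (connected_between cE); first by left.
  by move=> z [/subset_closure//|->].
have : f @` (E `|` [set x]) `<=` ~` closure (f @` E).
  apply: (connected_split (V := ~` [set f x]) (b := f x) cB) => //.
  - exact/closed_openC/closed_closure.
  - exact/closed_openC/accessible_closed_set1.
  - move=> _ [z [Ez|->] <-]; last by left.
    by right=> /= fzx; apply: ncl; rewrite -fzx; apply: subset_closure; exists z.
  - move=> _ [z [Ez|->] <-]; last by move=> _; exact.
    by case; apply: subset_closure; exists z.
  - by exists x => //; right.
move=> /(_ (f e)); apply; first by exists e => //; left.
by apply: subset_closure; exists e.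
Qed.

Lemma connected_image (T T' : topologicalType) (f : T -> T') (A : set T) :
  continuous f -> connected A -> connected (f @` A).
Proof.
move=> fc cA; apply: connected_continuous_connected => //.
exact: continuous_subspaceT.
Qed.

Lemma cover_compact_cvg (X : topologicalType) (z : nat -> X) (x : X) :
  z @ \oo --> x -> cover_compact (range z `|` [set x]).
Proof.
move=> zx I D g og cov.
have [j Dj gjx] : cover D g x by apply: cov; right.
have [N _ zN] : \forall n \near \oo, g j (z n).
  by apply: zx; apply: open_nbhs_nbhs; split=> //; exact: og.
have /choice[h hP] : forall n, exists i, D i /\ g i (z n).
  move=> n; have [|i Di gi] := cov (z n); last by exists i.
  by left; exists n.
exists [fset i in j :: map h (iota 0 N)]%fset.
  move=> i; rewrite !inE => /orP[/eqP->|/mapP[n _ ->]]; apply/mem_set => //.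
  by have [] := hP n.
move=> _ [[n _ <-]|->]; last by exists j => //=; rewrite !inE eqxx.
have [Nn|nN] := leqP N n; first by exists j; [rewrite /= !inE eqxx|exact: zN].
exists (h n); last by have [] := hP n.
by rewrite /= !inE map_f ?orbT// mem_iota.
Qed.

(** Suppose that [f @` C i] leaves an open neighbourhood [O] of [f x] for
arbitrarily large [i]. Being connected, such an image meets the boundary of every
open [W] around [f x] with [closure W `<=` O]. By regularity such a [W] can be
enlarged to absorb the boundary point found. This gives an increasing sequence
of open sets [W n] and points [z n] converging to [x] with [f (z n)] in
[W n.+1] but not in [W n]; hence no finitely many [W n] cover the image of the
compact set formed by [x] and the [z n]. *)
Lemma image_shrinking_connected (X Y : topologicalType) (f : X -> Y) (x : X)
    (C : nat -> set X) (O : set Y) :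
  regular_space Y -> preserving f ->
  (forall i, connected (C i)) -> (forall i, C i x) ->
  (forall U, nbhs x U -> \forall i \near \oo, C i `<=` U) ->
  nbhs (f x) O -> \forall i \near \oo, f @` C i `<=` O.
Proof.
move=> regY [fK fC] cC Cx Cshrink nO.
have regO (y : Y) G : nbhs y G -> exists N, [/\ open N, N y & closure N `<=` G].
  move=> /(regY y)[N nN NG]; exists N^°; split; [exact: open_interior|exact: nN|].
  by apply: subset_trans NG; apply: closureS; exact: interior_subset.
apply: contrapT => nshrink.
have far n : exists2 i, (n <= i)%N & ~ (f @` C i `<=` O).
  apply: contrapT => H; apply: nshrink; exists n => // i /= ni.
  by apply: contrapT => ?; apply: H; exists i.
pose inv (W : set Y) := [/\ open W, W (f x) & closure W `<=` O^°].
(* The case distinction on [inv W] makes the step total, so that it can be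
   iterated on plain sets. *)
have step (nW : nat * set Y) : exists zW : X * set Y, inv nW.2 ->
    [/\ exists2 i, (nW.1 <= i)%N & C i zW.1, ~ nW.2 (f zW.1),
        inv zW.2, zW.2 (f zW.1) & nW.2 `<=` zW.2].
  case: nW => n W /=.
  have [[oW Wx WO]|] := pselect (inv W); last by exists (x, W).
  have [i ni Ci] := far n.
  (* a point of [C i] mapped to the boundary of [W] *)
  have [z Cz [clz nWz]] : exists2 z, C i z & closure W (f z) /\ ~ W (f z).
    apply: contrapT => H; apply: Ci; apply: subset_trans (interior_subset (A := O)).
    apply: subset_trans WO; apply: subset_trans (@subset_closure _ _).
    apply: (connected_split (V := ~` closure W) (b := f x)) => //.
    - exact: fC.
    - exact/closed_openC/closed_closure.
    - move=> _ [z Cz <-]; have [Wz|Wz] := pselect (W (f z)); first by left.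
      by right=> clz; apply: H; exists z.
    - by move=> y _ /subset_closure Wy.
    - by exists x.
  have [N [oN Nz NO]] : exists N, [/\ open N, N (f z) & closure N `<=` O^°].
    by apply: regO; apply: open_nbhs_nbhs; split; [exact: open_interior|exact: WO].
  exists (z, W `|` N) => _ /=; split=> //.
  - by exists i.
  - split; [exact: openU|by left|].
    by rewrite closureU subUset.
  - by right.
have [W0 [oW0 W0x W0O]] : exists N, inv N by apply: regO; exact: nbhs_interior.
have [g gP] := choice step.
pose W := fix W n := if n is m.+1 then (g (m, W m)).2 else W0.
pose z n := (g (n, W n)).1.
have invW n : inv (W n) by elim: n => // n IH; have [] := gP (n, W n) IH.
have CzP n : exists2 i, (n <= i)%N & C i (z n) by have [] := gP (n, W n) (invW n).
have nWz n : ~ W n (f (z n)) by have [] := gP (n, W n) (invW n).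
have Wz n : W n.+1 (f (z n)) by have [] := gP (n, W n) (invW n).
have Wmono m n : (m <= n)%N -> W m `<=` W n.
  elim: n => [|n IH]; first by rewrite leqn0 => /eqP->.
  rewrite leq_eqVlt => /predU1P[->//|]; rewrite ltnS => /IH mn.
  by apply: (subset_trans mn); have [] := gP (n, W n) (invW n).
have zx : z @ \oo --> x.
  move=> U /Cshrink[N _ NU]; exists N => // n /= Nn.
  by have [i ni Ci] := CzP n; apply: (NU i) => //=; exact: leq_trans ni.
have [] := fK _ (cover_compact_cvg zx) nat setT W.
- by move=> n _; have [] := invW n.
- by move=> _ [_ [[n _ <-]|->] <-]; [exists n.+1|exists 0].
move=> D _; pose M := (\max_(n <- D) n)%N.
move=> /(_ (f (z M))) []; first by exists (z M) => //; left; exists M.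
move=> n /= nD Wn; have nM : (n <= M)%N.
  exact: (@leq_bigmax_seq nat (enum_fset D) xpredT id).
exact: (nWz _ (Wmono _ _ nM _ Wn)).
Qed.

(** The sequence [u] is joined to its limit [q] by connected sets that shrink to
[q]; if [q] is an SC point, every sequence converging to [q] has a subsequence of
this kind. *)
Definition connected_limit (X : topologicalType) (u : nat -> X) (q : X) : Prop :=
  exists C : nat -> set X,
    [/\ forall i, connected (C i), forall i, C i (u i), forall i, C i q
      & forall U, nbhs q U -> \forall i \near \oo, C i `<=` U].

(** The finitely many terms before [N] are joined to [q] by the whole space. *)
Lemma connected_limit_sub (X : topologicalType) (u v : nat -> X) q N :
  connected_space X -> connected_limit u q ->
  (forall i, (N <= i)%N -> exists2 m, (i <= m)%N & v i = u m) ->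
  connected_limit v q.
Proof.
move=> cX [C [cC Cu Cq Cs]] uv.
have /choice[h hP] : forall i, exists m, (N <= i)%N -> (i <= m)%N /\ v i = u m.
  move=> i; have [/uv[m im vm]|_] := leqP N i; first by exists m.
  by exists 0.
exists (fun i => if (N <= i)%N then C (h i) else setT); split.
- by move=> i; case: ifP => //.
- by move=> i; case: ifP => // /hP[_ ->].
- by move=> i; case: ifP.
- move=> U /Cs[M _ MU]; exists (maxn M N) => // i /=.
  rewrite geq_max => /andP[Mi Ni]; rewrite Ni; apply: MU => /=.
  by have [ih _] := hP i Ni; exact: leq_trans ih.
Qed.

(** Player II only moves in [D], always with [f (x n)] outside the neighbourhood
[W0] of [f p], and avoids the closures of the components [E] of [f @^-1` H]
already visited. This is possible because these closures miss [p]. The connected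
sets joining a subsequence of this play to its limit [q] eventually lie in
[f @^-1` H] and share [q], so they put two of its members into one component. *)
Lemma within_cvg_of_strategy (X Y : topologicalType) (f : X -> Y) (p : X)
    (D : set X) (sigma : seq X -> set X) :
  T3_space Y -> preserving f -> (forall s, nbhs p (sigma s)) ->
  (forall x : nat -> X, (forall n, D (x n)) ->
    (forall n, sigma (mkseq x n) (x n)) ->
    exists k q, strictly_increasing k /\ connected_limit (x \o k) q) ->
  f @ within D (nbhs p) --> f p.
Proof.
move=> [regY accY] fpres nsigma win W0 nW0; apply: contrapT => nW.
have [W1 nW1 clW1] := regY _ _ (nbhs_interior nW0).
(* The closure of [W1] lies in the interior of [W0], so that [f q] in
   [closure W1] would bring points [f (x n)] into [W0]. *)
pose H := ~` closure W1.
have oH : open H by exact/closed_openC/closed_closure.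
pose E (y : X) := connected_component (f @^-1` H) y.
have nE y : ~ closure (E y) p.
  move=> clp.
  have /(_ (f p)) clfp := image_closure_connected accY fpres
    (@component_connected _ (f @^-1` H) y).
  have {clfp} : closure (f @` E y) (f p) by apply: clfp; exists p.
  move=> /(_ W1^° (nbhs_interior nW1)) [_ [[z Ez <-] W1z]].
  apply: (connected_component_sub Ez : H (f z)).
  exact: subset_closure (interior_subset W1z).
pose avoid (s : seq X) : set X := [set z | forall y, y \in s -> ~ closure (E y) z].
have navoid s : nbhs p (avoid s).
  apply: (@filter_all_seq _ _ _ s (fun y => ~` closure (E y))) => y _.
  apply: open_nbhs_nbhs; split; last exact: nE.
  exact/closed_openC/closed_closure.
have [x xP] : exists x : nat -> X, forall n,
    [/\ D (x n), sigma (mkseq x n) (x n), avoid (mkseq x n) (x n) & ~ W0 (f (x n))].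
  apply: (@infinite_play X (fun s y => [/\ D y, sigma s y, avoid s y & ~ W0 (f y)])).
  move=> s; apply: contrapT => /forallNP no; apply: nW.
  apply: filterS2 (nsigma s) (navoid s) => z sz az Dz.
  by apply: contrapT => W0z; apply: (no z).
have [k [q [kinc [C [cC Cu Cq Cs]]]]] : exists k q,
    strictly_increasing k /\ connected_limit (x \o k) q.
  by apply: win => n; have [] := xP n.
have shr O := @image_shrinking_connected _ _ f q C O regY fpres cC Cq Cs.
have Hq : H (f q).
  move=> clq; have /shr[N _ /(_ N (leqnn N))] : nbhs (f q) W0 by exact: clW1.
  move=> /(_ (f (x (k N)))) CW.
  by have [_ _ _] := xP (k N); apply; apply: CW; exists (x (k N)) => //; exact: Cu.
have [N _ CH] := shr H (open_nbhs_nbhs (conj oH Hq)).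
have [_ _ + _] := xP (k N.+1); move=> /(_ (x (k N))).
apply; first by apply: map_f; rewrite mem_iota /=; apply: kinc.
apply: subset_closure; exists (C N `|` C N.+1); last by right; exact: Cu.
split; first by left; exact: Cu.
- by move=> z [Cz|Cz]; [apply: (CH N)|apply: (CH N.+1)] => //=; exists z.
- by apply: connectedU => //; exists q.
Qed.

(** * Hereditary strategies *)

(** The intersection of [sigma u] over the subsequences [u] of [t]: a subsequence
of [x :: t'] drops [x] or keeps it. Every subsequence of a play against
[hereditary sigma] is then a play against [sigma]. *)
Fixpoint hereditary (T : Type) (sigma : seq T -> set T) (t : seq T) : set T :=
  if t is x :: t' then
    hereditary sigma t' `&` hereditary (fun u => sigma (x :: u)) t'
  else sigma [::].

Lemma nbhs_hereditary (X : topologicalType) (p : X) sigma t :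
  (forall s, nbhs p (sigma s)) -> nbhs p (hereditary sigma t).
Proof.
elim: t sigma => [|x t IH] sigma nsigma; first exact: nsigma.
by apply: filterI; apply: IH.
Qed.

Lemma hereditary_subseq (T : eqType) (sigma : seq T -> set T) t u :
  subseq u t -> hereditary sigma t `<=` sigma u.
Proof.
elim: t sigma u => [|x t IH] sigma u; first by rewrite subseq0 => /eqP->.
case: u => [|y u] /= ut z [tz xtz]; first by apply: IH tz; exact: sub0seq.
by case: eqP ut => [->|_] ut; [exact: IH xtz|exact: IH tz].
Qed.

(** The play is constrained only from round [m] on: in a product a coordinate
starts to be controlled only after a move has changed it. Every subsequence of
such a play is, after [m] terms are dropped, a play against [sigma] itself, so it
has a convergent subsequence, and the SC property provides the connected sets. *)
Lemma hereditary_strategy (X : topologicalType) (p : X) :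
  winnable_at p -> SC_space X ->
  exists tau : seq X -> set X, (forall s, nbhs p (tau s)) /\
    forall (x : nat -> X) m, (forall n, (m <= n)%N -> tau (mkseq x n) (x n)) ->
    forall k, strictly_increasing k ->
    exists h q, strictly_increasing h /\ connected_limit (x \o (k \o h)) q.
Proof.
move=> [sigma [nsigma win]] SC; exists (hereditary sigma).
split=> [s|x m xP k kinc]; first exact: nbhs_hereditary.
pose k1 i := k (i + m)%N.
have k1inc : strictly_increasing k1 by move=> i j ij; apply: kinc; rewrite ltn_add2r.
have [|k2 [q [k2inc xq]]] := win (x \o k1).
  move=> n; apply: hereditary_subseq (subseq_mkseq _ _ k1inc) _ _; apply: xP.
  by apply: leq_trans (strictly_increasing_ge kinc _); exact: leq_addl.
have [k3 [C [k3inc cC CP Cq]]] := SC q _ xq.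
exists (fun i => k2 (k3 i) + m)%N, q; split.
  by move=> i j /k3inc /k2inc ij; rewrite ltn_add2r.
by exists C; split=> // i; have [] := CP i.
Qed.

(** * Products *)

Section products.
Variables (S : choiceType) (X : S -> topologicalType).
Implicit Types (p a z : prod_topology X) (L : seq S).

Lemma nbhs_box p L (B : forall s, set (X s)) :
  (forall s, s \in L -> nbhs (p s) (B s)) ->
  nbhs p [set z : prod_topology X | forall s, s \in L -> B s (z s)].
Proof.
move=> nB; apply: (@filter_all_seq _ _ _ L (fun s z => B s (z s))) => s sL.
exact: (@proj_continuous S X s p (B s) (nB s sL)).
Qed.

(** The sets containing a finite box around [p] form a filter that converges to
[p] in each coordinate, hence in the product. *)
Lemma nbhs_box_sub p (U : set (prod_topology X)) : nbhs p U ->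
  exists L (B : forall s, set (X s)), (forall s, nbhs (p s) (B s)) /\
    [set z | forall s, s \in L -> B s (z s)] `<=` U.
Proof.
pose F : set_system (prod_topology X) := fun U =>
  exists L (B : forall s, set (X s)), (forall s, nbhs (p s) (B s)) /\
    [set z | forall s, s \in L -> B s (z s)] `<=` U.
have FF : Filter F.
  split.
  - by exists [::], (fun=> setT); split=> // s; exact: filterT.
  - move=> P Q [L [B [nB BP]]] [M [C [nC CQ]]].
    exists (L ++ M), (fun s => B s `&` C s).
    split; first by move=> s; exact: filterI.
    move=> z BCz; split; [apply: BP|apply: CQ] => s sL.
      by have [] := BCz s _; rewrite // mem_cat sL.
    by have [] := BCz s _; rewrite // mem_cat sL orbT.
  - move=> P Q PQ [L [B [nB BP]]]; exists L, B; split => //.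
    exact: subset_trans PQ.
suff : F --> p by apply.
apply/cvg_sup => s V [_ [[N oN <-] Np] NV].
(* The box is [N] in the coordinate [s]; in a coordinate [t] with [s = t] the set
   [N] has to be transported along this equality. *)
exists [:: s], (fun t => if pselect (s = t) is left e then
  (ecast t (set (X t)) e N) else setT); split.
  move=> t; case: pselect => [e|_]; last exact: filterT.
  by case: t / e; exact: open_nbhs_nbhs.
move=> z /(_ s); rewrite mem_seq1 eqxx => /(_ isT).
case: pselect => // e; rewrite (Prop_irrelevance e erefl) /= => Nz.
exact: NV.
Qed.

Definition box (A : forall s, set (X s)) : set (prod_topology X) :=
  [set z | forall s, A s (z s)].

Definition finite_change a : set (prod_topology X) :=
  [set z | exists L, forall s, s \notin L -> z s = a s].

(** Points that differ from [a] only in a fixed finite list [L] of coordinates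
are handled by induction on [L]: the set for [s :: L] is a union of slices
parallel to the factor [s], each attached to the connected set for [L]. The sets
for the various [L] all contain [a]. *)
Lemma connected_finite_change (A : forall s, set (X s)) a :
  (forall s, connected (A s)) -> (forall s, A s (a s)) ->
  connected (box A `&` finite_change a).
Proof.
move=> cA Aa.
pose K L : set (prod_topology X) :=
  [set z | (forall s, A s (z s)) /\ forall s, s \notin L -> z s = a s].
have Ka L : K L a by split.
have cK L : connected (K L).
  elim: L => [|s L IH].
    suff -> : K [::] = [set a] by exact: connected1.
    apply/seteqP; split=> [z [_ za]|_ ->//].
    by apply: functional_extensionality_dep => s; exact: za.
  pose G z := K L `|` (dfwith z s @` A s : set (prod_topology X)).
  have -> : K (s :: L) = \bigcup_(z in K L) G z.
    apply/seteqP; split=> [z [Az za]|z [y Ky [[Az za]|[v Av <-]]]].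
    - exists (dfwith z s (a s)).
        split=> t; first by case: dfwithP.
        have [<-|st] := eqVneq s t => tL; rewrite ?dfwithin ?dfwithout//.
        by rewrite za// inE negb_or eq_sym st.
      right; exists (z s) => //; apply: functional_extensionality_dep => t.
      by have [<-|st] := eqVneq s t; rewrite ?dfwithin// !dfwithout.
    - by split=> // t; rewrite inE negb_or => /andP[_]; exact: za.
    - have [Ay ya] := Ky; split=> t; first by case: dfwithP.
      rewrite inE negb_or eq_sym => /andP[st tL]; rewrite dfwithout//.
      exact: ya.
  apply: bigcup_connected; first by exists a => z _; left.
  move=> z Kz; apply: connectedU => //.
    exists z; split=> //; exists (z s); first by have [] := Kz.
    apply: functional_extensionality_dep => t.
    by have [<-|st] := eqVneq s t; rewrite ?dfwithin// !dfwithout.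
  by apply: connected_image => //; exact: dfwith_continuous.
have -> : box A `&` finite_change a = \bigcup_L K L.
  apply/seteqP; split=> [z [Az [L za]]|z [L _ [Az za]]]; first by exists L.
  by split=> //; exists L.
by apply: bigcup_connected => //; exists a => L _.
Qed.

Lemma dense_finite_change (A : forall s, set (X s)) a :
  (forall s, A s (a s)) ->
  box A `<=` closure (box A `&` finite_change a).
Proof.
move=> Aa z Az U /nbhs_box_sub[L [B [nB BU]]].
exists (fun s => if s \in L then z s else a s); split; last first.
  by apply: BU => s sL; rewrite sL; exact: nbhs_singleton.
split; first by move=> s; case: ifP.
by exists L => s /negbTE ->.
Qed.

Lemma connected_prod (A : forall s, set (X s)) :
  (forall s, connected (A s)) -> connected (box A).
Proof.
move=> cA.
have [[a Aa]|/forallNP A0] := pselect ((box A) !=set0).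
  apply: (connected_between (connected_finite_change cA Aa)); first by move=> z [].
  exact: dense_finite_change.
suff -> : box A = set0 by exact: connected0.
by rewrite -subset0 => z /A0.
Qed.

Lemma connected_limit_prod (u : nat -> prod_topology X) (q : prod_topology X) :
  (forall s, connected_limit (fun i => u i s) (q s)) -> connected_limit u q.
Proof.
move=> uq; pose C s := projT1 (cid (uq s)).
have CP s : [/\ forall i, connected (C s i), forall i, C s i (u i s),
    forall i, C s i (q s)
  & forall U, nbhs (q s) U -> \forall i \near \oo, C s i `<=` U].
  exact: projT2 (cid (uq s)).
exists (fun i => box (fun s => C s i)); split.
- by move=> i; apply: connected_prod => s; have [] := CP s.
- by move=> i s; have [] := CP s.
- by move=> i s; have [] := CP s.
move=> U /nbhs_box_sub[L [B [nB BU]]].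
have : \forall i \near \oo, forall s, s \in L -> C s i `<=` B s.
  apply: (@filter_all_seq _ _ _ L (fun s i => C s i `<=` B s)) => s _.
  by have [_ _ _] := CP s; apply.
by apply: filterS => i CB z Cz; apply: BU => s /CB; apply; exact: Cz.
Qed.

(** Player I restricts the coordinates that some earlier move in
[finite_change p] has changed, following there the hereditary strategy of the
factor. Each coordinate either always agrees with [p] or is controlled from some
round on, so every subsequence of the play has a further subsequence joined to
a limit in that coordinate. Only countably many coordinates are ever changed,
and a diagonal subsequence serves them all. *)
Lemma prod_strategy (p : prod_topology X) :
  (forall s, [/\ connected_space (X s), winnable (X s) & SC_space (X s)]) ->
  exists sigma : seq (prod_topology X) -> set (prod_topology X),
    (forall t, nbhs p (sigma t)) /\
    forall x : nat -> prod_topology X, (forall n, finite_change p (x n)) ->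
    (forall n, sigma (mkseq x n) (x n)) ->
    exists k q, strictly_increasing k /\ connected_limit (x \o k) q.
Proof.
move=> XP.
have ex_tau s : exists tau : seq (X s) -> set (X s),
    (forall t, nbhs (p s) (tau t)) /\
    forall (x : nat -> X s) m, (forall n, (m <= n)%N -> tau (mkseq x n) (x n)) ->
    forall k, strictly_increasing k ->
    exists h q, strictly_increasing h /\ connected_limit (x \o (k \o h)) q.
  by have [_ ws scs] := XP s; exact: hereditary_strategy.
pose tau s := projT1 (cid (ex_tau s)).
have ntau s (t : seq (X s)) : nbhs (p s) (tau s t).
  exact: proj1 (projT2 (cid (ex_tau s))) t.
have tauw s := proj2 (projT2 (cid (ex_tau s))).
(* Histories may contain arbitrary points; those with infinitely many changed
   coordinates are ignored, for otherwise this set need not be a neighbourhood. *)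
exists (fun t => [set z | forall y : prod_topology X, y \in t -> finite_change p y ->
  forall s, y s <> p s -> tau s (map (@^~ s) t) (z s)]).
split=> [t|x xfin xP].
  apply: (@filter_all_seq _ _ _ t (fun (y z : prod_topology X) => finite_change p y ->
    forall s, y s <> p s -> tau s (map (@^~ s) t) (z s))) => y _.
  have [[L yL]|ny] := pselect (finite_change p y); last first.
    exact: filterS filterT.
  have := nbhs_box (p := p) (L := L) (B := fun s => tau s (map (@^~ s) t))
    (fun s _ => ntau s _).
  apply: filterS => z zL _ s ys; apply: zL; apply: contrapT => /negP/yL; exact: ys.
pose good s k := exists q, connected_limit (fun i => x (k i) s) q.
have good_sub s k : strictly_increasing k ->
    exists2 h, strictly_increasing h & good s (k \o h).
  move=> kinc.
  have [xs|/existsNP[m xms]] := pselect (forall n, x n s = p s).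
    exists id => //; exists (p s), (fun=> [set p s]).
    split=> [i|i|i|U nU]; [exact: connected1|exact: xs|by []|].
    by apply: nearW => i _ ->; exact: nbhs_singleton.
  have [|h [q [hinc hq]]] := @tauw s (fun n => x n s) m.+1 _ _ kinc.
    move=> n mn; have := xP n (x m) _ (xfin m) s xms.
    by rewrite -map_comp; apply; rewrite map_f// mem_iota.
  by exists h => //; exists q.
have good_diag s k d N : good s k ->
    (forall i, (N <= i)%N -> exists2 m, (i <= m)%N & d i = k m) -> good s d.
  move=> [q kq] dk; exists q; have [cs _ _] := XP s.
  apply: (@connected_limit_sub _ _ _ _ N cs kq) => i /dk[m im ->].
  by exists m.
have cF : countable [set s | exists n, x n s <> p s].
  have -> : [set s | exists n, x n s <> p s] = \bigcup_n [set s | x n s <> p s].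
    by apply/seteqP; split=> [s [n xn]|s [n _ xn]]; exists n.
  apply: bigcup_countable => // n _; have [L xL] := xfin n.
  apply: finite_set_countable; apply: sub_finite_set (finite_seq L) => s xs.
  by apply: contrapT => /negP/xL.
(* The requirement number [j] concerns the coordinate numbered [j] by [e]. *)
have [e einj] := countable_injP _ cF.
have [||d dinc dP] := @diagonal_subsequence
    (fun j k => forall s, (exists n, x n s <> p s) -> e s = j -> good s k).
- move=> j k kinc.
  have [[s [Fs es]]|/forallNP nos] :=
      pselect (exists s, (exists n, x n s <> p s) /\ e s = j).
    have [h hinc hP] := good_sub s k kinc; exists h => // t Ft et.
    by have <- : s = t by apply: einj; rewrite ?es ?et//; exact: mem_set.
  by exists id => // s Fs es; case: (nos s).
- by move=> j k d N Pk dk s Fs es; exact: good_diag (Pk s Fs es) dk.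
have dgood s : good s d.
  have [Fs|/forallNP nF] := pselect (exists n, x n s <> p s); first exact: dP.
  exists (p s), (fun=> [set p s]).
  split=> [i|i|i|U nU]; [exact: connected1| |by []|].
    by apply: contrapT; exact: nF.
  by apply: nearW => i _ ->; exact: nbhs_singleton.
exists d, (fun s => projT1 (cid (dgood s))); split=> //.
by apply: connected_limit_prod => s; exact: (projT2 (cid (dgood s))).
Qed.

(** On a small box [U] with connected factors the values of [f] at the points of
[finite_change p] lie in [W]; these points form a connected dense subset of [U],
so all values of [f] on [U] lie in the closure of [W]. *)
Lemma preserving_prod_continuous :
  (forall s : S, [/\ connected_space (X s), locally_connected (X s),
                      winnable (X s) & SC_space (X s)]) ->
   forall Y : topologicalType, T3_space Y ->
     forall f : prod_topology X -> Y, preserving f -> continuous f.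
Proof.
move=> XP Y [regY accY] f fpres p V nV.
have [W nW WV] := regY _ _ nV.
have [|sigma [nsigma win]] := @prod_strategy p.
  by move=> s; have [] := XP s.
have := within_cvg_of_strategy (conj regY accY) fpres nsigma win nW.
move=> /nbhs_box_sub[L [B [nB BW]]].
(* In the coordinates outside [L] the whole factor is connected. *)
have exU s : exists U, [/\ nbhs (p s) U, connected U,
    s \in L -> U `<=` B s & s \notin L -> U = setT].
  have [sL|sL] := boolP (s \in L).
    have [_ /(_ _ _ (nB s))[U [oU Up cU UB]] _ _] := XP s.
    by exists U; split => //; exact: open_nbhs_nbhs.
  by exists setT; split=> //; [exact: filterT|have [] := XP s].
pose U s := projT1 (cid (exU s)).
have Uprop s : [/\ nbhs (p s) (U s), connected (U s),
    s \in L -> U s `<=` B s & s \notin L -> U s = setT].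
  exact: projT2 (cid (exU s)).
have Up s : U s (p s) by have [/nbhs_singleton] := Uprop s.
have cU : connected (box U `&` finite_change p).
  by apply: connected_finite_change => // s; have [] := Uprop s.
have nU : nbhs p (box U).
  have : nbhs p [set z : prod_topology X | forall s, s \in L -> U s (z s)].
    by apply: nbhs_box => s _; have [] := Uprop s.
  apply: filterS => z Uz s; have [sL|sL] := boolP (s \in L); first exact: Uz.
  by have [_ _ _ ->] := Uprop s.
apply: filterS nU => z Uz; apply: WV.
have := image_closure_connected accY fpres cU.
move=> /(_ (f z)) clfz.
have {}clfz : closure (f @` (box U `&` finite_change p)) (f z).
  by apply: clfz; exists z => //; exact: dense_finite_change.
apply: closureS clfz => _ [y [Uy py] <-]; apply: BW => // s sL.
by have [_ _ + _] := Uprop s; apply.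
Qed.

End products.

(** * First countable spaces *)

Section first_countable.
Variable X : topologicalType.
Hypothesis fcX : first_countable X.

(** The [n]-th set is the intersection of the members of the countable base with
number at most [n]. *)
Lemma first_countable_shrinking (x : X) : exists W : nat -> set X,
  (forall n, nbhs x (W n)) /\
  forall U, nbhs x U -> \forall n \near \oo, W n `<=` U.
Proof.
have [B [/countable_injP[e einj] nB BU]] := fcX x.
pose G n : set X := [set z | forall V, B V -> e V = n -> V z].
have nG n : nbhs x (G n).
  have [[V [BV eV]]|/forallNP nV] := pselect (exists V, B V /\ e V = n).
    apply: filterS (nB _ BV) => z Vz V' BV' eV'.
    by have -> : V' = V by apply: einj; rewrite ?eV ?eV'//; exact: mem_set.
  by apply: filterS filterT => z _ V BV eV; case: (nV V).
exists (fun n => [set z | forall i, i \in iota 0 n.+1 -> G i z]); split.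
  by move=> n; apply: filter_all_seq => i _; exact: nG.
move=> U /BU[V BV VU]; exists (e V) => // n eVn z Wz; apply: VU.
by apply: (Wz (e V)) => //; rewrite mem_iota.
Qed.

Lemma first_countable_winnable : winnable X.
Proof.
move=> p; have [W [nW WU]] := first_countable_shrinking p.
exists (fun s => W (size s)); split=> // x xW.
exists id, p; split=> // U /WU; apply: filterS => n; apply.
by have := xW n; rewrite size_mkseq.
Qed.

(** The connecting sets are connected neighbourhoods taken inside a shrinking
sequence. *)
Lemma first_countable_SC : locally_connected X -> SC_space X.
Proof.
move=> lcX x u ux; have [W [nW WU]] := first_countable_shrinking x.
have /choice[C CP] : forall n, exists V : set X,
    [/\ open V, V x, connected V & V `<=` W n] by move=> n; exact: lcX.
have [|k kinc uC] := @extract_subsequence (fun n m => C n (u m)).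
  move=> n N; have [oC Cx _ _] := CP n.
  have [M _ MC] := ux _ (open_nbhs_nbhs (conj oC Cx)).
  by exists (maxn N M); [exact: leq_maxl|apply: MC; exact: leq_maxr].
exists k, C; split=> //; first by move=> n; have [] := CP n.
  by move=> n; split=> //; have [] := CP n.
by move=> U /WU; apply: filterS => n; apply: subset_trans; have [] := CP n.
Qed.

End first_countable.

(** * Invariance under homeomorphism *)

Section homeomorphism.
Variables (X Z : topologicalType) (h : X -> Z) (g : Z -> X).
Hypotheses (hK : cancel h g) (gK : cancel g h).
Hypotheses (hc : continuous h) (gc : continuous g).

Lemma homeo_connected_space : connected_space X -> connected_space Z.
Proof.
rewrite /connected_space => cX.
have -> : [set: Z] = h @` setT; last exact: connected_image.
by apply/seteqP; split=> // z _; exists (g z).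
Qed.

Lemma homeo_locally_connected : locally_connected Z -> locally_connected X.
Proof.
move=> lcZ x U nU.
have nU' : nbhs (h x) (g @^-1` U) by apply: gc; rewrite hK.
have [V [oV Vx cV VU]] := lcZ _ _ nU'.
exists (h @^-1` V); split=> //.
- by apply: open_comp => // z _; exact: hc.
- have -> : h @^-1` V = g @` V; last exact: connected_image.
  apply/seteqP; split=> [z Vz|_ [z Vz <-]]; last by rewrite /= gK.
  by exists (h z).
- by move=> z /VU /=; rewrite hK.
Qed.

Lemma homeo_winnable : winnable Z -> winnable X.
Proof.
move=> wZ p; have [sigma [nsigma win]] := wZ (h p).
exists (fun s => h @^-1` sigma (map h s)); split=> [s|x xP].
  by apply: hc; exact: nsigma.
have [|k [q [kinc xq]]] := win (h \o x).
  by move=> n; have := xP n; rewrite /= /mkseq -map_comp.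
exists k, (g q); split=> //.
have -> : x \o k = g \o (h \o x \o k) by apply/funext => i; rewrite /= hK.
exact: cvg_comp xq (@gc q).
Qed.

Lemma homeo_SC : SC_space Z -> SC_space X.
Proof.
move=> scZ x u ux.
have [|k [C [kinc cC Cu CU]]] := scZ (h x) (h \o u).
  exact: cvg_comp ux (@hc x).
exists k, (fun i => g @` C i); split=> // [i|i|U nU].
- exact: connected_image.
- by have [Ci Cx] := Cu i; split; [exists (h (u (k i)))|exists (h x)].
- have /CU : nbhs (h x) (g @^-1` U) by apply: gc; rewrite hK.
  by apply: filterS => i CUi _ [z Cz <-]; exact: CUi.
Qed.

End homeomorphism.

(** * Connected linearly ordered spaces *)

Section lots.
Local Open Scope order_scope.
Import Order.TTheory.
Context {d : Order.disp_t} {L : orderTopologicalType d}.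
Implicit Types (a b p x y : L).
Hypothesis cL : connected_space L.

(** Basic neighbourhoods are intervals, and intervals are order convex. *)
Lemma nbhs_convex x (U : set L) : nbhs x U ->
  exists V : set L, [/\ open V, V x, V `<=` U &
    forall a b z, V a -> V b -> a <= z <= b -> V z].
Proof.
rewrite itv_nbhsE => -[i [oi xi] iU]; exists [set` i]; split=> //.
  exact: itv_open_ends_open.
move=> a b z /=; case: i {oi xi iU} => l r.
rewrite !itv_boundlr => /andP[la _] /andP[_ br] /andP[az zb].
by rewrite (le_trans la)//= (le_trans _ br).
Qed.

(** A closed interval is the image of the whole space under clamping, which is
continuous. *)
Lemma connected_itvcc a b : a <= b -> connected [set z | a <= z <= b].
Proof.
move=> ab; pose c x := Order.max a (Order.min x b).
have cc : continuous c.
  apply: max_fun_continuous; first by move=> x; exact: cvg_cst.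
  by apply: min_fun_continuous => x; [exact: cvg_id|exact: cvg_cst].
have -> : [set z | a <= z <= b] = c @` setT; last exact: connected_image.
apply/seteqP; split=> [z /andP[az zb]|_ [x _ <-]].
  by exists z => //; rewrite /c min_l// max_r.
by rewrite /= /c le_max lexx ge_max ab ge_min lexx orbT.
Qed.

Lemma connected_convex (A : set L) :
  (forall a b z, A a -> A b -> a <= z <= b -> A z) -> connected A.
Proof.
move=> Aconv.
have [[a Aa]|/forallNP A0] := pselect (A !=set0); last first.
  suff -> : A = set0 by exact: connected0.
  by rewrite -subset0 => z /A0.
pose I x : set L := [set z | Order.min a x <= z <= Order.max a x].
have -> : A = \bigcup_(x in A) I x.
  apply/seteqP; split=> [x Ax|z [x Ax]].
    by exists x => //; rewrite /I /= ge_min le_max lexx !orbT.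
  by apply: Aconv; rewrite ?minEle ?maxEle; case: ifP.
apply: bigcup_connected; first by exists a => x _; rewrite /I /= ge_min le_max lexx.
by move=> x _; apply: connected_itvcc; rewrite ge_min le_max lexx.
Qed.

Lemma lots_locally_connected : locally_connected L.
Proof.
move=> x U /nbhs_convex[V [oV Vx VU Vconv]]; exists V; split=> //.
exact: connected_convex.
Qed.

Lemma lots_SC : SC_space L.
Proof.
move=> p u up.
exists id, (fun i => [set z | Order.min (u i) p <= z <= Order.max (u i) p]).
split=> //.
- by move=> i; apply: connected_itvcc; rewrite ge_min le_max lexx.
- by move=> i; rewrite /= !ge_min !le_max !lexx !orbT.
move=> U /nbhs_convex[V [oV Vp VU Vconv]].
have : \forall i \near \oo, V (u i) by apply: up; exact: open_nbhs_nbhs.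
apply: filterS => i Vi z zi; apply: VU.
by apply: Vconv zi; rewrite ?minEle ?maxEle; case: ifP.
Qed.

(** Without a least upper bound, the upper bounds of [A] and the points below some
element of [A] would be two complementary open sets. *)
Lemma lots_sup (A : set L) a b : A a -> (forall x, A x -> x <= b) ->
  exists c, (forall x, A x -> x <= c) /\
    forall y, (forall x, A x -> x <= y) -> c <= y.
Proof.
move=> Aa Ab; apply: contrapT => /forallNP nosup.
pose D := [set x : L | exists2 y, A y & x < y].
pose E := [set x : L | forall y, A y -> y <= x].
have : setT `<=` E.
  apply: (connected_split (V := D) (b := b) cL) => //.
  - rewrite openE => x Ex.
    have [y [Ey yx]] : exists y, E y /\ y < x.
      apply: contrapT => H; apply: (nosup x); split=> // y Ey.
      by rewrite leNgt; apply/negP => yx; apply: H; exists y.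
    apply: filterS (open_nbhs_nbhs (conj (rray_open y) _)); last first.
      by rewrite /= in_itv /= andbT.
    move=> z /=; rewrite in_itv /= andbT => yz w /Ey /le_trans; apply.
    exact: ltW.
  - rewrite openE => x [y Ay xy].
    apply: filterS (open_nbhs_nbhs (conj (lray_open y) _)); last first.
      by rewrite /= in_itv.
    by move=> z /=; rewrite in_itv /= => zy; exists y.
  - move=> x _.
    have [Ex|/existsNP[y /not_implyP[Ay /negP]]] := pselect (E x).
      by left.
    by rewrite -ltNge => xy; right; exists y.
  - by move=> x _ Ex [y /Ex]; rewrite leNgt => /negP.
move=> /(_ a I) Ea; apply: (nosup a); split=> // y; exact.
Qed.

(** The infimum is the supremum of the lower bounds. *)
Lemma lots_inf (A : set L) a b : A a -> (forall x, A x -> b <= x) ->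
  exists c, (forall x, A x -> c <= x) /\
    forall y, (forall x, A x -> y <= x) -> y <= c.
Proof.
move=> Aa Ab.
have [|c [cub club]] := @lots_sup [set y | forall x, A x -> y <= x] b a Ab.
  by move=> y; exact.
by exists c; split=> // x Ax; apply: club => y; exact.
Qed.

(** For the convergence of a monotone sequence to [c] only one side of a
neighbourhood of [c] matters. The second alternative comes from basic intervals
without a lower bound, as they occur when [c] is the least point. *)
Lemma nbhs_left c (U : set L) : nbhs c U ->
  (exists2 y, y < c & forall z, y < z -> z <= c -> U z) \/
  (forall z, z <= c -> U z).
Proof.
rewrite itv_nbhsE => -[[l r] [oi]].
rewrite /= itv_boundlr => /andP[lc cr] iU.
have zr z : z <= c -> (BRight z <= r)%O.
  by move=> zc; apply: le_trans cr; rewrite leBSide.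
case: l oi lc iU => [s y|s] oi lc iU.
  have /= s0 := itv_open_ends_lside oi; subst s.
  left; exists y => // z yz zc; apply: iU => /=; rewrite itv_boundlr zr// andbT.
  by rewrite leBSide.
have /= s0 := itv_open_ends_linfty oi; subst s.
by right=> z zc; apply: iU => /=; rewrite itv_boundlr zr.
Qed.

Lemma nbhs_right c (U : set L) : nbhs c U ->
  (exists2 y, c < y & forall z, c <= z -> z < y -> U z) \/
  (forall z, c <= z -> U z).
Proof.
rewrite itv_nbhsE => -[[l r] [oi]].
rewrite /= itv_boundlr => /andP[lc cr] iU.
have zl z : c <= z -> (l <= BLeft z)%O.
  by move=> zc; apply: (le_trans lc); rewrite leBSide.
case: r oi cr iU => [s y|s] oi cr iU.
  have /= s0 := itv_open_ends_rside oi; subst s.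
  left; exists y => // z zc yz; apply: iU => /=; rewrite itv_boundlr zl//=.
have /= s0 := itv_open_ends_rinfty oi; subst s.
by right=> z zc; apply: iU => /=; rewrite itv_boundlr zl.
Qed.

Lemma nondecreasing_bounded_cvg (u : nat -> L) b :
  (forall i j, (i <= j)%N -> u i <= u j) -> (forall i, u i <= b) ->
  exists c : L, u @ \oo --> c.
Proof.
move=> umono ub.
have [|c [uc cu]] := @lots_sup (range u) (u 0) b (imageT u 0).
  by move=> _ [i _ <-].
have {}uc i : u i <= c by apply: uc; exists i.
exists c => U /nbhs_left[[y yc yU]|cU]; last by exists 0 => // i _; exact: cU.
have [N yN] : exists N, y < u N.
  apply: contrapT => /forallNP H.
  move: yc; rewrite ltNge => /negP; apply; apply: cu => _ [i _ <-].
  by rewrite leNgt; apply/negP.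
by exists N => // i /= Ni; apply: yU => //; exact: lt_le_trans (umono _ _ Ni).
Qed.

Lemma nonincreasing_bounded_cvg (u : nat -> L) b :
  (forall i j, (i <= j)%N -> u j <= u i) -> (forall i, b <= u i) ->
  exists c : L, u @ \oo --> c.
Proof.
move=> umono ub.
have [|c [uc cu]] := @lots_inf (range u) (u 0) b (imageT u 0).
  by move=> _ [i _ <-].
have {}uc i : c <= u i by apply: uc; exists i.
exists c => U /nbhs_right[[y cy yU]|cU]; last by exists 0 => // i _; exact: cU.
have [N yN] : exists N, u N < y.
  apply: contrapT => /forallNP H.
  move: cy; rewrite ltNge => /negP; apply; apply: cu => _ [i _ <-].
  by rewrite leNgt; apply/negP.
by exists N => // i /= Ni; apply: yU => //; exact: le_lt_trans (umono _ _ Ni) yN.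
Qed.

(** Call [n] a peak if no later term exceeds [u n]. Infinitely many peaks form a
nonincreasing subsequence; otherwise, beyond the last peak, each term is exceeded
by a later one. *)
Lemma monotone_subsequence (u : nat -> L) :
  exists2 k, strictly_increasing k &
    (forall i j, (i <= j)%N -> u (k i) <= u (k j)) \/
    (forall i j, (i <= j)%N -> u (k j) <= u (k i)).
Proof.
pose peak n := forall m, (n < m)%N -> u m <= u n.
have [inf_peak|/existsNP[N few]] :=
    pselect (forall N, exists2 m, (N <= m)%N & peak m).
  have [|k kinc kpeak] := @extract_subsequence (fun _ m => peak m).
    by move=> _; exact: inf_peak.
  exists k => //; right=> i j; rewrite leq_eqVlt => /predU1P[->//|/kinc].
  exact: kpeak.
have /choice[g gP] : forall n, exists m, (N <= n)%N -> (n < m)%N /\ u n <= u m.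
  move=> n; have [Nn|_] := leqP N n; last by exists 0.
  have /existsNP[m /not_implyP[nm /negP]] : ~ peak n.
    by move=> pn; apply: few; exists n.
  by rewrite -ltNge => /ltW unm; exists m.
pose k i := iter i g N.
have Nk i : (N <= k i)%N.
  by elim: i => // i IH; apply: (leq_trans IH); apply: ltnW; have [] := gP _ IH.
exists k; first by apply: strictly_increasingS => i; have [] := gP _ (Nk i).
left=> i j; elim: j => [|j IH]; first by rewrite leqn0 => /eqP->.
rewrite leq_eqVlt => /predU1P[->//|]; rewrite ltnS => /IH/le_trans; apply.
by have [] := gP _ (Nk j).
Qed.

(** The strategy is constant: an order bounded neighbourhood, whose bounds are
[p] itself on a side where [p] is an endpoint of the space. *)
Lemma lots_winnable : winnable L.
Proof.
move=> p.
have [a na] : exists a, nbhs p [set z | a <= z].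
  have [[a ap]|/forallNP nop] := pselect (exists a, a < p).
    exists a; apply: filterS (open_nbhs_nbhs (conj (rray_open a) _)).
      by move=> z /=; rewrite in_itv /= andbT => /ltW.
    by rewrite /= in_itv /= ap.
  exists p; apply: filterS filterT => z _ /=.
  by rewrite leNgt; apply/negP.
have [b nb] : exists b, nbhs p [set z | z <= b].
  have [[b pb]|/forallNP nop] := pselect (exists b, p < b).
    exists b; apply: filterS (open_nbhs_nbhs (conj (lray_open b) _)).
      by move=> z /=; rewrite in_itv /= => /ltW.
    by rewrite /= in_itv /= pb.
  exists p; apply: filterS filterT => z _ /=.
  by rewrite leNgt; apply/negP.
exists (fun=> [set z | a <= z] `&` [set z | z <= b]).
split=> [_|x xab]; first exact: filterI.
have [k kinc [kmono|kmono]] := monotone_subsequence x.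
- have [|c xc] := nondecreasing_bounded_cvg (b := b) kmono; last by exists k, c.
  by move=> i; have [] := xab (k i).
- have [|c xc] := nonincreasing_bounded_cvg (b := a) kmono; last by exists k, c.
  by move=> i; have [] := xab (k i).
Qed.

End lots.

(** * Continuity on products *)

Lemma connected_linearly_ordered_space (X : topologicalType) :
  connected_space X -> linearly_ordered_space X ->
  [/\ locally_connected X, winnable X & SC_space X].
Proof.
move=> cX [d [L [h [g [hK gK hc gc]]]]].
have cL := homeo_connected_space gK hc cX.
split.
- exact: homeo_locally_connected hK gK hc gc (lots_locally_connected cL).
- exact: homeo_winnable hK hc gc (lots_winnable cL).
- exact: homeo_SC hK hc gc (lots_SC cL).
Qed.

Theorem corollary3p9 (S : Type) (X : S -> topologicalType) :
  ((forall s : S, [/\ connected_space (X s), locally_connected (X s),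
                      winnable (X s) & SC_space (X s)]) ->
   forall Y : topologicalType, T3_space Y ->
     forall f : prod_topology X -> Y, preserving f -> continuous f)
  /\
  ((forall s : S,
      (connected_space (X s) /\ linearly_ordered_space (X s)) \/
      [/\ connected_space (X s), locally_connected (X s)
        & first_countable (X s)]) ->
   forall Y : topologicalType, T3_space Y ->
     forall f : prod_topology X -> Y, preserving f -> continuous f).
Proof.
(* Decidable equality of indices is needed to change single coordinates. *)
have main := @preserving_prod_continuous {classic S} X.
split=> // XP; apply: main => s.
case: (XP s) => [[cX]|[cX lcX fcX]].
  by move=> /(connected_linearly_ordered_space cX)[].
split=> //; first exact: first_countable_winnable.
exact: first_countable_SC.
Qed.
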